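(* Let $(p_k)_{k\ge 0}$ be a sequence of integers greater than $2$ and, for each $k\ge 0$, let $(s_{k,j})_{0\le j\le p_k-1}$ be real numbers with $s_{k,0}=0$ and $s_{k,j}>0$ for $1\le j\le p_k-1$. Let $P_k$, $k\ge 0$, be the associated trigonometric polynomials (defined in the context), viewed as continuous functions on the Bohr compactification $b\mathbb{R}$ of $\mathbb{R}$, and let $h$ be the normalized Haar measure of $b\mathbb{R}$. For $n\ge 0$ put $$d\sigma_n(t)=\prod_{k=0}^{n}|P_k(t)|^2\,dh(t).$$ Then the sequence $(\sigma_n)_{n\ge 0}$ converges in the weak-$\star$ topology to some probability measure $\sigma$ on $b\mathbb{R}$.
   Context: $b\mathbb{R}$ is the Bohr compactification of $\mathbb{R}$: the compact abelian group containing $\mathbb{R}$ as a dense subgroup (via a continuous injective homomorphism) such that restriction to $\mathbb{R}$ is an isometric $\star$-isomorphism of $C(b\mathbb{R})$ onto the algebra of almost periodic functions on $\mathbb{R}$. An almost periodic function and its continuous extension to $b\mathbb{R}$ are denoted by the same letter; in particular each $t\mapsto e^{i\lambda t}$, $\lambda\in\mathbb{R}$, is regarded as a continuous character of $b\mathbb{R}$. $h$ is the Haar probability measure on $b\mathbb{R}$; for almost periodic $f$, $\int_{b\mathbb{R}} f\,dh=\lim_{T\to\infty}\frac1{2T}\int_{-T}^{T}f(t)\,dt$. Measures on $b\mathbb{R}$ are regular Borel measures. Weak-$\star$ convergence $\mu_n\to\mu$ of probability measures on $b\mathbb{R}$ is equivalent to $\int e^{-i\lambda t}d\mu_n(t)\to\int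 e^{-i\lambda t}d\mu(t)$ for every $\lambda\in\mathbb{R}$. Polynomials: put $\overline{s_{k,0}}=0$ and $\overline{s_{k,j}}=\sum_{l=0}^{j}s_{k,l}$ for $1\le j\le p_k-1$. Define $h_0=1$ and $h_{k+1}=p_kh_k+\overline{s_{k,p_k-1}}$ (the real numbers $h_k$ are not to be confused with the measure $h$). Then $$P_k(t)=\frac1{\sqrt{p_k}}\sum_{j=0}^{p_k-1}e^{it(jh_k+\overline{s_{k,j}})}.$$ *)

(* Defs.v *)
From HB Require Import structures.
From mathcomp Require Import all_boot all_order all_algebra.
From mathcomp Require Import complex.
From mathcomp Require Import all_classical all_reals all_analysis.
From mathcomp Require Import measurable_realfun.

Set Implicit Arguments.
Unset Strict Implicit.
Unset Printing Implicit Defensive.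

Import Order.TTheory GRing.Theory Num.Theory numFieldNormedType.Exports.
Import ComplexField.Normc.

Local Open Scope classical_set_scope.
Local Open Scope complex_scope.
Local Open Scope ring_scope.

Definition expi (R : realType) (x : R) : R[i] := cos x +i* sin x.

Definition trig_poly (R : realType) (n : nat) (c : 'I_n -> R[i])
    (lam : 'I_n -> R) (t : R) : R[i] :=
  \sum_(j < n) c j * expi (lam j * t).

(* Almost periodic functions as the closure of the trigonometric polynomials
   for the uniform norm on the line. *)
Definition almost_periodic (R : realType) (f : R -> R[i]) : Prop :=
  forall e : R, 0 < e ->
    exists (n : nat) (c : 'I_n -> R[i]) (lam : 'I_n -> R),
      forall t : R, normc (f t - trig_poly c lam t) < e.

(* Any model of the Bohr compactification, written additively. The restriction map F |-> F \o emb
   is automatically a *-homomorphism, since the operations on functions are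
   pointwise, and isometric maps are injective; the last two fields thus say
   that restriction is an isometric *-isomorphism from C(bR) onto the almost
   periodic functions. *)
Record bohrCompactification (R : realType) := BohrCompactification {
  bohr_group :> topologicalZmodType;
  bohr_emb : R -> bohr_group;
  bohr_compact : compact [set: bohr_group];
  bohr_hausdorff : hausdorff_space bohr_group;
  bohr_embD : {morph bohr_emb : x y / x + y};
  bohr_emb_inj : injective bohr_emb;
  bohr_emb_continuous : continuous bohr_emb;
  bohr_emb_dense : dense (range bohr_emb);
  bohr_restriction : forall f : R -> R[i], almost_periodic f <->
    exists F : bohr_group -> R[i]^o, continuous F /\ F \o bohr_emb = f;
  bohr_isometry : forall F : bohr_group -> R[i]^o, continuous F ->
    sup [set normc (F (bohr_emb t)) | t in [set: R]] =
    sup [set normc (F x) | x in [set: bohr_group]]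
}.

(* [bohr_ext B apf] is the continuous extension of f to B; it is unique because
   the line is dense. *)
Definition bohr_ext (R : realType) (B : bohrCompactification R)
    (f : R -> R[i]) (apf : almost_periodic f) : B -> R[i]^o :=
  projT1 (cid ((bohr_restriction B f).1 apf)).
Arguments bohr_ext {R} B {f} apf _.

Lemma bohr_ext_continuous (R : realType) (B : bohrCompactification R)
  (f : R -> R[i]) (apf : almost_periodic f) : continuous (bohr_ext B apf).
Proof. by rewrite /bohr_ext; case: cid => F []. Qed.

Lemma bohr_extE (R : realType) (B : bohrCompactification R)
  (f : R -> R[i]) (apf : almost_periodic f) (t : R) :
  bohr_ext B apf (bohr_emb B t) = f t.
Proof. by rewrite /bohr_ext; case: cid => F /= [_ <-]. Qed.

(* Measurable types are pointed in the library, hence this alias. *)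
Definition pointed_at0 (K : topologicalZmodType) : Type := K.

HB.instance Definition _ (K : topologicalZmodType) :=
  Choice.copy (pointed_at0 K) K.
HB.instance Definition _ (K : topologicalZmodType) :=
  isPointed.Build (pointed_at0 K) (0 : K).

Definition borel (K : topologicalZmodType) : measurableType _ :=
  g_sigma_algebraType (@open K : set (set (pointed_at0 K))).

Definition regular (R : realType) (K : topologicalZmodType)
    (mu : {measure set (borel K) -> \bar R}) : Prop :=
  forall A : set (borel K), measurable A ->
    mu A = ereal_inf [set mu U | U in [set U : set K | open U /\ A `<=` U]] /\
    mu A = ereal_sup [set mu C | C in [set C : set K | compact C /\ C `<=` A]].

Definition haar_probability (R : realType) (K : topologicalZmodType)
    (h : probability (borel K) R) : Prop :=
  regular h /\
  forall (a : K) (A : set (borel K)), measurable A ->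
    h [set a + x | x in (A : set K)] = h A.

Section density_measure.
Local Open Scope ereal_scope.
Context {d : measure_display} {T : measurableType d} {R : realType}.
Variables (mu : {measure set T -> \bar R}) (w : T -> \bar R).
Hypotheses (mw : measurable_fun [set: T] w) (w0 : forall x, 0 <= w x).

Definition density_measure
    (_ : measurable_fun [set: T] w) (_ : forall x, 0 <= w x) (A : set T) :
    \bar R :=
  \int[mu]_(x in A) w x.

Let nu := density_measure mw w0.

Let nu0 : nu set0 = 0.
Proof. by rewrite /nu /density_measure integral_set0. Qed.

Let nu_ge0 A : 0 <= nu A.
Proof. by apply: integral_ge0 => x _; exact: w0. Qed.

Let nu_sigma_additive : semi_sigma_additive nu.
Proof.
move=> F mF tF mUF; rewrite /nu /density_measure ge0_integral_bigcup//.
- by apply: is_cvg_ereal_nneg_natsum => n _; apply: integral_ge0 => x _.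
- exact: measurable_funTS.
Qed.

HB.instance Definition _ := isMeasure.Build _ _ _ (density_measure mw w0)
  nu0 nu_ge0 nu_sigma_additive.

End density_measure.

(* R[i]^o is R[i] with the topology of its norm. *)
Definition complex_integral (d : measure_display) (T : measurableType d)
    (R : realType) (mu : {measure set T -> \bar R}) (F : T -> R[i]) : R[i]^o :=
  (\int[mu]_x complex.Re (F x))%R +i* (\int[mu]_x complex.Im (F x))%R.

Definition weak_star_cvg (R : realType) (K : topologicalZmodType)
    (mu_ : nat -> {measure set (borel K) -> \bar R})
    (mu : {measure set (borel K) -> \bar R}) : Prop :=
  forall F : K -> R[i]^o, continuous F ->
    complex_integral (mu_ n) F @[n --> \oo] --> complex_integral mu F.

Lemma normc_continuous (R : realType) : continuous (@normc R : R[i]^o -> R).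
Proof.
move=> x; apply/(@cvgrPdist_lt _ _ _ _ (@nbhs_filter R[i]^o x)) => e e0.
have : \forall y \near (x : R[i]^o), `|x - y| < e%:C.
  by apply/nbhs_ballP; exists e%:C => //=; rewrite ltcR.
apply: (@filterS _ _ (@nbhs_filter R[i]^o x)) => y; rewrite -[`|_|]/((normc (x - y))%:C) ltcR.
apply: le_lt_trans.
have revtri (a b : R[i]) : normc a - normc b <= normc (a - b).
  by rewrite lerBlDr -{1}(subrK b a) le_normcD.
rewrite ler_norml revtri andbT lerNl opprB -[normc (x - y)]normcN opprB.
exact: revtri.
Qed.

Lemma borel_continuous_measurable (R : realType) (K : topologicalZmodType)
  (g : K -> R) : continuous g -> measurable_fun [set: borel K] (g : borel K -> R).
Proof.
move=> /continuousP cg.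
apply: (measurability _ (@RGenOpens.measurableE R)) => //.
move=> _ [_ [x [y ->]] <-]; rewrite setTI.
by apply: sub_sigma_algebra; apply: cg; exact: interval_open.
Qed.

Section riesz_products.
Context {R : realType}.
Variables (p : nat -> nat) (s : nat -> nat -> R).

(* With spacers s and heights h_k = [height k],
     P_k(t) = p_k^(-1/2) \sum_(j < p_k) e^(it (j h_k + sbar k j))
   is [rank_one_poly k]; [bohr_poly k] is its extension to B, and
   [riesz_measure h n] is the measure with density |P_0|^2 ... |P_n|^2
   with respect to h. *)
Definition sbar (k j : nat) : R :=
  if j is 0%N then 0 else \sum_(0 <= l < j.+1) s k l.

Fixpoint height (k : nat) : R :=
  if k is k'.+1 then (p k')%:R * height k' + sbar k' (p k').-1 else 1.

Definition rank_one_poly (k : nat) (t : R) : R[i] :=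
  ((Num.sqrt (p k)%:R)^-1)%:C *
  \sum_(j < p k) expi (t * (j%:R * height k + sbar k j)).

Lemma rank_one_poly_ap (k : nat) : almost_periodic (rank_one_poly k).
Proof.
move=> e e0; exists (p k), (fun=> ((Num.sqrt (p k)%:R)^-1)%:C).
exists (fun j => j%:R * height k + sbar k j) => t.
rewrite /rank_one_poly /trig_poly mulr_sumr.
under eq_bigr do rewrite mulrC [t * _]mulrC mulrC.
by rewrite subrr normc0.
Qed.

Variable B : bohrCompactification R.

Definition bohr_poly (k : nat) : B -> R[i]^o := bohr_ext B (rank_one_poly_ap k).

Definition riesz_product (n : nat) (x : B) : R :=
  \prod_(0 <= k < n.+1) normc (bohr_poly k x) ^+ 2.

Lemma riesz_product_continuous (n : nat) : continuous (riesz_product n).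
Proof.
rewrite /riesz_product; elim: n.+1 => [|m IH] x.
  under eq_fun do rewrite big_geq//.
  exact: cvg_cst.
under eq_fun do rewrite big_nat_recr//=.
apply: cvgM; first exact: IH.
have cP : normc (bohr_poly m y) @[y --> x] --> normc (bohr_poly m x).
  by apply: continuous_comp; [exact: bohr_ext_continuous|exact: normc_continuous].
under eq_fun do rewrite expr2.
by rewrite expr2; apply: cvgM.
Qed.

Lemma measurable_riesz_product (n : nat) :
  measurable_fun [set: borel B] (EFin \o (riesz_product n : borel B -> R)).
Proof.
apply/measurable_EFinP.
exact: borel_continuous_measurable (@riesz_product_continuous n).
Qed.

Lemma riesz_product_ge0 (n : nat) (x : borel B) :
  (0 <= (EFin \o (riesz_product n : borel B -> R)) x)%E.
Proof.
by rewrite /= lee_fin /riesz_product prodr_ge0// => k _; rewrite sqr_ge0.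
Qed.

Definition riesz_measure (h : {measure set (borel B) -> \bar R}) (n : nat) :
    {measure set (borel B) -> \bar R} :=
  density_measure h (measurable_riesz_product n) (riesz_product_ge0 n).

End riesz_products.

(* Main.v *)
Require Import Defs.
From HB Require Import structures.
From mathcomp Require Import all_boot all_order all_algebra.
From mathcomp Require Import complex.
From mathcomp Require Import all_classical all_reals all_analysis.
From mathcomp Require Import ring lra measurable_realfun.

Set Implicit Arguments.
Unset Strict Implicit.
Unset Printing Implicit Defensive.

Import Order.TTheory GRing.Theory Num.Theory numFieldNormedType.Exports.

Local Open Scope classical_set_scope.
Local Open Scope ring_scope.

(* Since the frequencies of P_k are pairwise at distance at least h_k while the
   frequencies of |P_0|^2 ... |P_(k-1)|^2 are bounded by h_k - 1, multiplying by
   |P_k|^2 keeps the mean equal to 1. All Fourier coefficients are nonnegative,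
   and the constant term 1 of |P_k|^2 makes them nondecreasing in n; being
   bounded by the total mass 1, they converge. Trigonometric polynomials are
   uniformly dense in C(bR), so the integrals of every continuous function
   converge, and the Riesz-Markov theorem represents the limit functional by a
   regular probability measure. *)

(** * The Riesz-Markov theorem *)

(** The bound on the frequencies comes from telescoping: the largest frequency of [P_k] is
    [h_(k+1) - h_k], and these add up to [h_n - h_0] with [h_0 = 1]. That unit is the strict gap
    that keeps nonzero frequency differences of [P_n] away from the spectrum of the earlier factors.
    Conservation of mass serves twice: it bounds the coefficients, and it makes the integrals
    contractions for the uniform norm, uniformly in [n], so that convergence passes from
    trigonometric polynomials to their uniform limits. Monotonicity gives convergence of the whole
    sequence, so no compactness of the space of measures and no subsequence enters. All integrals
    are kept real by splitting characters into cosine and sine. Since each [|P_k|^2] is a sum of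
    cosines, sine means stay zero, and only the monotone cosine coefficients matter. These are
    defined by a recursion in [n] as functions on the whole line, so coinciding frequencies need no
    bookkeeping. *)

Section riesz_content.
Context {R : realType} {K : topologicalType}.
Variable L : (K -> R) -> R.
Hypothesis LD : forall f g : K -> R, continuous f -> continuous g ->
  L (f \+ g) = L f + L g.
Hypothesis LZ : forall (a : R) (f : K -> R), continuous f ->
  L (fun x => a * f x) = a * L f.
Hypothesis L_ge0 : forall f : K -> R, continuous f -> (forall x, 0 <= f x) ->
  0 <= L f.
Hypothesis L1 : L (cst 1) = 1.

Lemma functionalB (f g : K -> R) : continuous f -> continuous g ->
  L (fun x => f x - g x) = L f - L g.
Proof.
move=> cf cg; rewrite (_ : (fun x => _) = f \+ (fun x => -1 * g x)); last first.
  by apply/funext => x /=; rewrite mulN1r.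
by rewrite LD// ?LZ ?mulN1r// => x; apply: cvgM; [exact: cvg_cst|exact: cg].
Qed.

Lemma functional_cst a : L (cst a) = a.
Proof.
rewrite (_ : cst a = fun x => a * cst 1 x); last first.
  by apply/funext => x /=; rewrite mulr1.
by rewrite LZ ?L1 ?mulr1// => x; exact: cvg_cst.
Qed.

Lemma le_functional (f g : K -> R) : continuous f -> continuous g ->
  (forall x, f x <= g x) -> L f <= L g.
Proof.
move=> cf cg fg; rewrite -subr_ge0 -functionalB//; apply: L_ge0 => [x|x].
  by apply: cvgB; [exact: cg|exact: cf].
by rewrite subr_ge0.
Qed.

(** Vanishing off [U] stands in for the usual requirement of a compact support inside [U]; [cutoff]
    recovers a closed set inside [U] when one is needed. *)
Definition subordinate (U : set K) (f : K -> R) :=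
  [/\ continuous f, forall x, 0 <= f x, forall x, f x <= 1 &
      forall x, ~ U x -> f x = 0].

Lemma subordinateS U V f : U `<=` V -> subordinate U f -> subordinate V f.
Proof. by move=> UV [? ? ? f0]; split => // x Vx; apply: f0 => /UV. Qed.

Lemma subordinate_cst0 U : subordinate U (cst 0).
Proof. by split => // x; exact: cvg_cst. Qed.

(** For [f] subordinate to [U] and [e > 0], the cutoff lives on the closed set [{e <= f}], which
    lies inside [U], and [L] loses at most [e]. *)
Definition cutoff (f : K -> R) (e : R) (x : K) := Num.max (f x - e) 0.

Lemma cutoff_continuous (f : K -> R) e : continuous f -> continuous (cutoff f e).
Proof.
move=> cf x; apply: (@continuous_max R K (fun y => f y - e) (cst 0)).
  by apply: cvgB; [exact: cf|exact: cvg_cst].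
exact: cvg_cst.
Qed.

Lemma cutoff_ge0 f e x : 0 <= cutoff f e x.
Proof. by rewrite /cutoff le_max lexx orbT. Qed.

Lemma le_cutoff f e x : 0 <= e -> 0 <= f x -> cutoff f e x <= f x.
Proof. by move=> e0 f0; rewrite /cutoff ge_max f0 andbT gerBl. Qed.

Lemma cutoff_eq0 f e x : ~ (e <= f x) -> cutoff f e x = 0.
Proof.
move=> /negP; rewrite -ltNge => fe.
by rewrite /cutoff max_r// subr_le0 ltW.
Qed.

Lemma functional_cutoff (f : K -> R) e : continuous f -> L f <= L (cutoff f e) + e.
Proof.
move=> cf; rewrite -[X in _ <= _ + X]functional_cst -LD; last 2 first.
  exact: cutoff_continuous.
  by move=> x; exact: cvg_cst.
apply: le_functional => // [x|x].
  by apply: cvgD; [exact: cutoff_continuous|exact: cvg_cst].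
by rewrite /= /cutoff -lerBlDr le_max lexx.
Qed.

Lemma closed_superlevel (f : K -> R) e : continuous f -> closed [set x : K | e <= f x].
Proof.
by move=> cf; apply: (@preimage_closed _ _ f [set y | e <= y]) => //; exact: closed_ge.
Qed.

Lemma superlevel_subordinate U f e : subordinate U f -> 0 < e ->
  [set x | e <= f x] `<=` U.
Proof.
move=> [_ _ _ fU] e0 x /=; apply: contraPP => /fU ->.
by rewrite leNgt e0.
Qed.

Local Open Scope ereal_scope.

Definition riesz_content (U : set K) : \bar R :=
  ereal_sup [set (L f)%:E | f in subordinate U].

Lemma functional_le_content U f : subordinate U f -> (L f)%:E <= riesz_content U.
Proof. by move=> Uf; apply: ereal_sup_ubound; exists f. Qed.

Lemma riesz_content_le U y :
  (forall f, subordinate U f -> (L f)%:E <= y) -> riesz_content U <= y.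
Proof. by move=> h; apply: ge_ereal_sup => _ [f Uf <-]; exact: h. Qed.

Lemma le_riesz_content U V : U `<=` V -> riesz_content U <= riesz_content V.
Proof.
move=> UV; apply: riesz_content_le => f Uf.
by apply: functional_le_content; exact: subordinateS Uf.
Qed.

Lemma riesz_content_ge0 U : 0 <= riesz_content U.
Proof.
by rewrite -[0]/(0%R%:E) -(functional_cst 0) functional_le_content//;
  exact: subordinate_cst0.
Qed.

Lemma riesz_content_le1 U : riesz_content U <= 1.
Proof.
apply: riesz_content_le => f [cf f0 f1 _]; rewrite lee_fin -L1.
by apply: le_functional => // x; exact: cvg_cst.
Qed.

Lemma riesz_contentT : riesz_content setT = 1.
Proof.
apply/eqP; rewrite eq_le riesz_content_le1 -[1]/(1%R%:E) -L1.
by apply: functional_le_content; split => [x|x|x|x /(_ I)]//=; exact: cvg_cst.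
Qed.

Lemma riesz_content0 : riesz_content set0 = 0.
Proof.
apply/eqP; rewrite eq_le riesz_content_ge0 andbT.
apply: riesz_content_le => f [_ _ _ f0].
rewrite (_ : f = cst 0%R) ?functional_cst//.
by apply/funext => x; exact: f0.
Qed.

Lemma riesz_content_fin U : riesz_content U \is a fin_num.
Proof.
rewrite fin_numE -ltNye -ltey (lt_le_trans _ (riesz_content_ge0 U)) ?ltNy0//=.
by rewrite (le_lt_trans (riesz_content_le1 U)) ?ltry.
Qed.

Lemma riesz_content_adherent U e : (0 < e)%R ->
  exists2 f, subordinate U f & riesz_content U <= (L f + e)%:E.
Proof.
move=> e0.
have [_ [f Uf <-]] := ub_ereal_sup_adherent e0 (riesz_content_fin U).
by rewrite lteBlDr// => /ltW h; exists f => //; rewrite EFinD.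
Qed.

Hypotheses (hK : hausdorff_space K) (cK : compact [set: K]).

(* With [phi] a Urysohn function vanishing off [U] and equal to 1 on the part of
   [{e <= f}] outside [V], the cutoff of [f] splits into [g phi + g (1 - phi)],
   subordinate to [U] and [V] respectively. *)
Lemma riesz_contentU U V : open U -> open V ->
  riesz_content (U `|` V) <= riesz_content U + riesz_content V.
Proof.
move=> oU oV; apply/lee_addgt0Pr => e e0; apply: riesz_content_le => f UVf.
have [cf f0 f1 _] := UVf.
set C := [set x | (e <= f x)%R].
have clCV : closed (C `\` V).
  by apply: closedI; [exact: closed_superlevel|exact: open_closedC].
have clU : closed (~` U) by exact: open_closedC.
have CVU : ~` U `&` (C `\` V) = set0.
  apply/seteqP; split => // x [nU [Cx nV]].
  by have [] := superlevel_subordinate UVf e0 Cx.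
have /(@uniform_separatorP _ R)[phi [cphi phi01 phi0 phi1]] :=
  normal_uniform_separator (compact_normal hK cK) clU clCV CVU.
have phi_itv x : (0 <= phi x <= 1)%R.
  by have /= := phi01 (phi x) (ex_intro2 _ _ x I erefl); rewrite in_itv.
have phi_ge0 x : (0 <= phi x)%R by have /andP[] := phi_itv x.
have phi_le1 x : (phi x <= 1)%R by have /andP[] := phi_itv x.
set g := cutoff f e.
have cg : continuous g by exact: cutoff_continuous.
have g1 x : (g x <= 1)%R by rewrite (le_trans _ (f1 x))// le_cutoff// ltW.
have cgp : continuous (fun x => g x * phi x)%R.
  by move=> x; apply: cvgM; [exact: cg|exact: cphi].
have cgq : continuous (fun x => g x * (1 - phi x))%R.
  by move=> x; apply: cvgM; [exact: cg|apply: cvgB; [exact: cvg_cst|exact: cphi]].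
have gU : subordinate U (fun x => g x * phi x)%R.
  split => // x; first by rewrite mulr_ge0// cutoff_ge0.
    by rewrite mulr_ile1// cutoff_ge0.
  by move=> nU; rewrite (phi0 (phi x)) ?mulr0//; exists x.
have gV : subordinate V (fun x => g x * (1 - phi x))%R.
  split => // x; first by rewrite mulr_ge0// ?cutoff_ge0// subr_ge0.
    by rewrite mulr_ile1// ?cutoff_ge0// ?subr_ge0// gerBl.
  move=> nV; have [Cx|nC] := pselect (C x).
    by rewrite (phi1 (phi x)) ?subrr ?mulr0//; exists x.
  by rewrite /g cutoff_eq0// mul0r.
apply: (@le_trans _ _ (L g + e)%:E); first by rewrite lee_fin functional_cutoff.
rewrite EFinD leeD2r//.
rewrite (_ : g = ((fun x => g x * phi x) \+ (fun x => g x * (1 - phi x)))%R).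
  by rewrite LD// EFinD leeD// functional_le_content.
by apply/funext => x /=; rewrite -mulrDr addrC subrK mulr1.
Qed.

Lemma riesz_content_bigsetU (U : (set K)^nat) n : (forall i, open (U i)) ->
  riesz_content (\big[setU/set0]_(i < n) U i) <= \sum_(i < n) riesz_content (U i).
Proof.
move=> oU; elim: n => [|n ih]; first by rewrite !big_ord0 riesz_content0.
rewrite !big_ord_recr/= (le_trans (riesz_contentU _ _))//.
  by rewrite -bigcup_mkord; apply: bigcup_open => i _.
by rewrite leeD2r.
Qed.

(** The compact set [{e <= f}] is covered by finitely many [U i], so the cutoff of [f] is
    subordinate to a finite union and finite subadditivity applies. *)
Lemma riesz_content_bigcup (U : (set K)^nat) : (forall i, open (U i)) ->
  riesz_content (\bigcup_i U i) <= \sum_(i <oo) riesz_content (U i).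
Proof.
move=> oU; apply/lee_addgt0Pr => e e0; apply: riesz_content_le => f Uf.
have [cf f0 f1 _] := Uf.
set C := [set x | (e <= f x)%R].
have cC : compact C.
  by apply: (subclosed_compact _ cK) => //; exact: closed_superlevel.
have [N _ CN] : \forall n \near \oo, C `<=` \big[setU/set0]_(i < n) U i.
  (* The finite unions increase with [n]: around a point of [U i], the neighbourhood [U i] is
     absorbed by every union with [n > i]. *)
  move/compact_near_coveringP : cC.
  move/(_ _ \oo (fun n => \big[setU/set0]_(i < n) U i)); apply.
  move=> x Cx; have [i _ Uix] := superlevel_subordinate Uf e0 Cx.
  exists (U i, [set n | (i < n)%N]) => /=.
    split; last by exists i.+1.
    by apply: open_nbhs_nbhs; split.
  case=> y n /= [Uiy /= ltin].
  by rewrite -bigcup_mkord; exists i.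
move/(_ N (leqnn N)) in CN.
apply: (@le_trans _ _ (L (cutoff f e) + e)%:E).
  by rewrite lee_fin functional_cutoff.
rewrite EFinD leeD2r//.
apply: (@le_trans _ _ (riesz_content (\big[setU/set0]_(i < N) U i))).
  apply: functional_le_content; split.
  - exact: cutoff_continuous.
  - exact: cutoff_ge0.
  - by move=> x; rewrite (le_trans _ (f1 x))// le_cutoff// ltW.
  - by move=> x Ux; apply: cutoff_eq0 => /CN.
apply: (le_trans (riesz_content_bigsetU _ oU)).
rewrite -(big_mkord xpredT (fun i => riesz_content (U i))).
by apply: nneseries_lim_ge => i _ _; exact: riesz_content_ge0.
Qed.

Definition riesz_outer (A : set K) : \bar R :=
  ereal_inf [set riesz_content U | U in [set U | open U /\ A `<=` U]].

Lemma riesz_outer_open U : open U -> riesz_outer U = riesz_content U.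
Proof.
move=> oU; apply/eqP; rewrite eq_le; apply/andP; split.
  by apply: ereal_inf_lbound; exists U => //; split.
by apply: le_ereal_inf_tmp => _ [V [oV UV] <-]; exact: le_riesz_content.
Qed.

Lemma riesz_outer_ge0 A : 0 <= riesz_outer A.
Proof.
by apply: le_ereal_inf_tmp => _ [V _ <-]; exact: riesz_content_ge0.
Qed.

Lemma riesz_outer0 : riesz_outer set0 = 0.
Proof. by rewrite riesz_outer_open ?riesz_content0//; exact: open0. Qed.

Lemma le_riesz_outer : {homo riesz_outer : A B / A `<=` B >-> A <= B}.
Proof.
move=> A B AB; apply: ereal_inf_le_tmp => _ [U [oU BU] <-].
by exists U => //; split => //; exact: subset_trans BU.
Qed.

Lemma riesz_outer_fin A : riesz_outer A \is a fin_num.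
Proof.
rewrite fin_numE -ltNye -ltey (lt_le_trans _ (riesz_outer_ge0 A)) ?ltNy0//=.
rewrite (@le_lt_trans _ _ 1) ?ltry// -riesz_contentT.
by apply: ereal_inf_lbound; exists setT => //; split => //; exact: openT.
Qed.

Lemma riesz_outer_adherent A e : (0 < e)%R ->
  exists U, [/\ open U, A `<=` U & riesz_content U <= riesz_outer A + e%:E].
Proof.
move=> e0.
have [_ [U [oU AU] <-] /ltW h] := lb_ereal_inf_adherent e0 (riesz_outer_fin A).
by exists U.
Qed.

Lemma riesz_outer_sigma_subadditive : sigma_subadditive riesz_outer.
Proof.
move=> A; apply/lee_addgt0Pr => e e0.
have /choice[U HU] n : exists U, [/\ open U, A n `<=` U &
    riesz_content U <= riesz_outer (A n) + (e / (2 ^ n.+1)%:R)%:E].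
  by apply: riesz_outer_adherent; rewrite divr_gt0// ltr0n expn_gt0.
have oU n : open (U n) by have [] := HU n.
apply: (@le_trans _ _ (riesz_content (\bigcup_n U n))).
  apply: ereal_inf_lbound; exists (\bigcup_n U n) => //; split.
    by apply: bigcup_open => i _.
  by apply: subset_bigcup => i _; have [] := HU i.
apply: (le_trans (riesz_content_bigcup oU)).
apply: le_trans (epsilon_trick _ _ (ltW e0)) => [|n]; last exact: riesz_outer_ge0.
apply: lee_nneseries => [n *|n *]; first exact: riesz_content_ge0.
by have [] := HU n.
Qed.

(** An open [V] containing the test set replaces it. Take [f] nearly optimal for [V] inside [U],
    then [k] nearly optimal for [V] minus [C = {e / 3 <= f}], which contains [V] minus [U]. The
    cutoff of [f] lives on [C], where [k] vanishes, so their sum is still at most 1 and subordinate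
    to [V]. Two thirds of [e] pay for near-optimality, one for the cutoff. *)
Lemma open_caratheodory U : open U -> riesz_outer.-caratheodory U.
Proof.
move=> oU.
pose mu : {outer_measure set K -> \bar R} := HB.pack riesz_outer
  (isOuterMeasure.Build R K riesz_outer riesz_outer0 riesz_outer_ge0
    le_riesz_outer riesz_outer_sigma_subadditive).
apply: (@le_caratheodory_measurable R K mu) => X /=.
apply: le_ereal_inf_tmp => _ [V [oV XV] <-].
apply: (@le_trans _ _ (riesz_outer (V `&` U) + riesz_outer (V `&` ~` U))).
  by apply: leeD; apply: le_riesz_outer; exact: setSI.
apply/lee_addgt0Pr => e e0; have e30 : (0 < e / 3)%R by rewrite divr_gt0.
rewrite riesz_outer_open; last exact: openI.
have [f VUf Lf] := riesz_content_adherent (V `&` U) e30.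
set C := [set x | (e / 3 <= f x)%R].
have oVC : open (V `\` C).
  by apply: openI => //; apply: closed_openC; apply: closed_superlevel; case: VUf.
have CVU : C `<=` V `&` U by exact: superlevel_subordinate.
have [k VCk Lk] := riesz_content_adherent (V `\` C) e30.
have [[cf f0 f1 fVU] [ck k0 k1 kVC]] := (VUf, VCk).
set g := cutoff f (e / 3).
have cg : continuous g by exact: cutoff_continuous.
have gk : subordinate V (g \+ k)%R.
  have gkC x : C x -> k x = 0%R by move=> Cx; apply: kVC => -[].
  have gnC x : ~ C x -> g x = 0%R by exact: cutoff_eq0.
  split => [x|x|x|x nV] /=.
  - by apply: cvgD; [exact: cg|exact: ck].
  - by rewrite addr_ge0// cutoff_ge0.
  - have [Cx|nCx] := pselect (C x); last by rewrite gnC// add0r.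
    by rewrite gkC// addr0 (le_trans _ (f1 x))// le_cutoff// ltW.
  - by rewrite gnC ?kVC ?addr0// => [[]|/CVU[]].
have := functional_le_content gk; rewrite LD//.
move/(leeD2r e%:E); apply: le_trans.
apply: (@le_trans _ _ ((L f + e / 3)%:E + (L k + e / 3)%:E)).
  apply: leeD => //; apply: le_trans Lk; rewrite -riesz_outer_open//.
  by apply: le_riesz_outer => x [Vx nU]; split => // /CVU[].
have := functional_cutoff (e / 3) cf; rewrite -/g -!EFinD lee_fin; lra.
Qed.

End riesz_content.

(** * Integrability of continuous functions on a compact group *)

Section compact_integration.
Context {R : realType} {K : topologicalZmodType}.
Hypothesis cK : compact [set: K].

Lemma continuous_bounded_on_compact (f : K -> R) : continuous f ->
  exists2 M, 0 < M & forall x, `|f x| <= M.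
Proof.
move=> cf.
have : compact (f @` [set: K]).
  by apply: continuous_compact => //; exact: continuous_subspaceT.
move=> /compact_bounded[M [_ /(_ (`|M| + 1))]].
rewrite (le_lt_trans (ler_norm _))// ?ltrDl// => /(_ isT) fM.
exists (`|M| + 1) => [|x]; first by rewrite ltr_wpDl.
by apply: fM; exists x.
Qed.

Lemma continuous_integrable (mu : {finite_measure set (borel K) -> \bar R})
  (f : K -> R) : continuous f ->
  mu.-integrable [set: borel K] (EFin \o (f : borel K -> R)).
Proof.
move=> cf; have [M M0 fM] := continuous_bounded_on_compact cf.
apply: measurable_bounded_integrable => //.
- by rewrite ltey_eq fin_num_measure.
- exact: borel_continuous_measurable.
- exists M; split; first exact: num_real.
  by move=> y My x _; apply: le_trans (fM x) (ltW My).
Qed.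

End compact_integration.

(** * Representation of a positive functional by a regular measure *)

Section riesz_markov.
Context {R : realType} {K : topologicalZmodType}.
Hypotheses (hK : hausdorff_space K) (cK : compact [set: K]).
Variable L : (K -> R) -> R.
Hypothesis LD : forall f g : K -> R, continuous f -> continuous g ->
  L (f \+ g) = L f + L g.
Hypothesis LZ : forall (a : R) (f : K -> R), continuous f ->
  L (fun x => a * f x) = a * L f.
Hypothesis L_ge0 : forall f : K -> R, continuous f -> (forall x, 0 <= f x) ->
  0 <= L f.
Hypothesis L1 : L (cst 1) = 1.

Let outer_L : {outer_measure set (pointed_at0 K) -> \bar R} :=
  HB.pack (riesz_outer L) (isOuterMeasure.Build R K (riesz_outer L)
    (riesz_outer0 LZ L1) (riesz_outer_ge0 LZ L1)
    (@le_riesz_outer _ _ L) (riesz_outer_sigma_subadditive LD LZ L_ge0 L1 hK cK)).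

Lemma borel_caratheodory (A : set (borel K)) : measurable A ->
  (riesz_outer L).-caratheodory A.
Proof.
move: A; apply: smallest_sub.
  split.
  - exact: (caratheodory_measurable_set0 outer_L).
  - by move=> A; rewrite setTD; exact: (@caratheodory_measurable_setC _ _ outer_L).
  - exact: (@caratheodory_measurable_bigcup _ _ outer_L).
by move=> U oU; exact: open_caratheodory.
Qed.

Lemma riesz_outer_sigma_additive :
  semi_sigma_additive (riesz_outer L : set (borel K) -> \bar R).
Proof.
move=> F mF tF mUF.
by apply: (@caratheodory_measure_sigma_additive _ _ outer_L) => // [i|];
  exact: borel_caratheodory.
Qed.

Lemma riesz_outerT : riesz_outer L [set: K] = 1%E.
Proof. by rewrite riesz_outer_open ?riesz_contentT//; exact: openT. Qed.

Lemma riesz_outer_setC (A : set (borel K)) : measurable A ->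
  (riesz_outer L A + riesz_outer L (~` A) = 1)%E.
Proof.
by move=> /borel_caratheodory/(_ setT); rewrite riesz_outerT !setTI => <-.
Qed.

Local Open Scope ereal_scope.

(** Outer regularity is built into [riesz_outer]. Inner regularity follows by complements: an open
    set tightly around the complement of [A] has a closed, hence compact, complement inside [A], and
    the total mass 1 converts one estimate into the other. *)
Lemma riesz_measure_exists : exists2 sigma : probability (borel K) R,
  regular sigma & forall U, open U -> sigma U = riesz_content L U.
Proof.
pose mu : set (borel K) -> \bar R := riesz_outer L.
pose mm := isMeasure.Build _ (borel K) R mu (riesz_outer0 LZ L1)
  (riesz_outer_ge0 LZ L1) riesz_outer_sigma_additive.
pose mu' : {measure set (borel K) -> \bar R} := HB.pack mu mm.
pose sigma : probability (borel K) R := HB.pack mu mm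
  (Measure_isProbability.Build _ (borel K) R mu' riesz_outerT).
have sigmaE A : sigma A = riesz_outer L A by [].
clearbody sigma.
exists sigma; last by move=> U oU; rewrite sigmaE riesz_outer_open.
move=> A mA; split.
  rewrite [LHS]sigmaE /riesz_outer; congr ereal_inf; apply: eq_imagel => U [oU _].
  by rewrite [RHS]sigmaE riesz_outer_open.
apply/eqP; rewrite eq_le; apply/andP; split; last first.
  apply: ge_ereal_sup => _ [C [_ CA] <-].
  by rewrite [leLHS]sigmaE [leRHS]sigmaE le_riesz_outer.
apply/lee_addgt0Pr => e e0.
have [U [oU AU Ue]] := riesz_outer_adherent LD LZ L_ge0 L1 (~` A) e0.
have mU : measurable (U : set (borel K)) by exact: sub_sigma_algebra.
have CU : riesz_outer L (~` U) <=
    ereal_sup [set sigma C | C in [set C : set K | compact C /\ C `<=` A]].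
  apply: ereal_sup_ubound; exists (~` U) => //; split.
    by apply: (subclosed_compact _ cK) => //; exact: open_closedC.
  by apply: subsetCl.
apply: le_trans (leeD2r _ CU).
have := riesz_outer_setC mU; have := riesz_outer_setC mA.
rewrite -riesz_outer_open// in Ue; rewrite [leLHS]sigmaE.
have fin B := riesz_outer_fin LD LZ L_ge0 L1 B.
move: Ue; rewrite -(fineK (fin A)) -(fineK (fin U)).
rewrite -(fineK (fin (~` A))) -(fineK (fin (~` U))).
rewrite -!EFinD !lee_fin => Ue [] h1 [] h2; lra.
Qed.

(* The slice [u n.+1] of [f] between heights [(n+1) d] and [(n+2) d] is at most
   [d] on [{f > (n+1) d}] and 0 elsewhere, while the slice [u n] below it equals
   [d] there; summing [L (u n.+1) <= I (u n)] loses only the bottom slice. *)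
Lemma functional_le_integral (sigma : probability (borel K) R) (f : K -> R) :
  (forall U, open U -> sigma U = riesz_content L U) ->
  continuous f -> (forall x, 0 <= f x)%R -> (L f <= \int[sigma]_x f x)%R.
Proof.
move=> sigmaE cf f0; apply/ler_addgt0Pr => d d0.
pose I (g : K -> R) : R := (\int[sigma]_(x in [set: borel K]) g x)%R.
pose t n x := Num.min (f x) (n%:R * d)%R.
have ct n : continuous (t n).
  move=> x; apply: (@continuous_min R K f (cst (n%:R * d)%R)); first exact: cf.
  exact: cvg_cst.
pose u n x := (t n.+1 x - t n x)%R.
have cu n : continuous (u n) by move=> x; apply: cvgB; exact: ct.
have u0 n x : (0 <= u n x)%R.
  by rewrite subr_ge0 /t le_min !ge_min lexx/= ler_pM2r// ler_nat leqnSn orbT.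
have ud n x : (u n x <= d)%R.
  rewrite lerBlDr /t -natr1 mulrDl mul1r addrC addr_minr le_min !ge_min lexx orbT.
  by rewrite lerDr ltW.
have u_eq0 n x : ~ (n%:R * d < f x)%R -> u n x = 0%R.
  move=> /negP; rewrite -leNgt => fn.
  have fn1 : (f x <= n.+1%:R * d)%R by rewrite (le_trans fn)// ler_pM2r// ler_nat.
  by rewrite /u /t !min_l// subrr.
have u_eqd n x : (n.+1%:R * d < f x)%R -> u n x = d.
  move=> /ltW fn1; have fn : (n%:R * d <= f x)%R.
    by rewrite (le_trans _ fn1)// ler_pM2r// ler_nat.
  by rewrite /u /t !min_r// -natr1 mulrDl mul1r addrC addKr.
have ID g k : continuous g -> continuous k -> I (g \+ k)%R = (I g + I k)%R.
  by move=> cg ck; rewrite /I RintegralD//; exact: continuous_integrable.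
have step n : (L (u n.+1) <= I (u n))%R.
  pose U := [set x | n.+1%:R * d < f x]%R.
  have oU : open U.
    apply: (@open_comp _ _ f [set y | n.+1%:R * d < y]%R).
      by move=> x _; exact: cf.
    exact: open_gt.
  have mU : measurable (U : set (borel K)) by exact: sub_sigma_algebra.
  have h1 : (L (u n.+1) <= d * fine (sigma U))%R.
    rewrite mulrC -ler_pdivrMr// mulrC -LZ//.
    rewrite -lee_fin fineK ?fin_num_measure// sigmaE//.
    apply: functional_le_content; split => [x|x|x|x nU].
    - by apply: cvgM; [exact: cvg_cst|exact: cu].
    - by rewrite mulr_ge0// invr_ge0 ltW.
    - by rewrite mulrC ler_pdivrMr// mul1r.
    - by rewrite u_eq0 ?mulr0.
  apply: (le_trans h1).
  rewrite -lee_fin /I /Rintegral fineK; last first.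
    by apply: integrable_fin_num => //; exact: continuous_integrable.
  rewrite EFinM fineK ?fin_num_measure//.
  rewrite -[U in sigma U]setIT -integral_indic// -ge0_integralZl//=; last 2 first.
    exact/measurable_EFinP/measurable_indic.
    by rewrite lee_fin ltW.
  apply: ge0_le_integral => //.
  - by move=> x _; rewrite mule_ge0// lee_fin// ltW.
  - by apply/measurable_EFinP; exact: measurable_funM.
  - by apply/measurable_EFinP; exact: borel_continuous_measurable.
  - move=> x _; rewrite -EFinM lee_fin indicE.
    have [Ux|Ux] := boolP (x \in U); last by rewrite mulr0.
    by rewrite mulr1 u_eqd//; rewrite inE in Ux.
(* The base case is [t 1 <= d] with [t 0 = 0]. The index shift between the two sides disappears once
   both truncations equal [f]. *)
have main n : (L (t n.+1) <= d + I (t n))%R.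
  have tS m : t m.+1 = (t m \+ u m)%R.
    by apply/funext => x; rewrite /u /= addrC subrK.
  elim: n => [|n ih].
    rewrite (_ : I _ = 0%R) ?addr0.
      rewrite -[leRHS](functional_cst LZ L1); apply: (le_functional LD LZ L_ge0) => // x.
        exact: cvg_cst.
      by rewrite /t ge_min mul1r lexx orbT.
    rewrite (_ : t 0%N = cst 0%R); last first.
      by apply/funext => x; rewrite /t mul0r min_r.
    by rewrite /I Rintegral_cst// mul0r.
  rewrite tS LD// [in I _]tS ID// addrA lerD//.
have [M M0 fM] := continuous_bounded_on_compact cK cf.
(* With this choice [N * d] exceeds the bound [M] of [f], so truncation at height [N * d] changes
   nothing. *)
pose N := (Num.truncn (M / d)).+1.
have tN n : (N <= n)%N -> t n = f.
  move=> Nn; apply/funext => x; rewrite /t min_l//.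
  rewrite (le_trans (ler_norm _))// (le_trans (fM x))//.
  rewrite -ler_pdivrMr//; apply: (@le_trans _ _ N%:R); last by rewrite ler_nat.
  by rewrite ltW// truncnS_gt.
have := main N; rewrite !tN// addrC; exact.
Qed.

Local Close Scope ereal_scope.

(** The inequality for nonnegative functions suffices: adding a constant, on which both sides agree,
    extends it to all continuous functions, and applying it to [-f] reverses it. *)
Lemma riesz_markov : exists2 sigma : probability (borel K) R,
  regular sigma &
  forall f : K -> R, continuous f -> \int[sigma]_(x in [set: borel K]) f x = L f.
Proof.
have [sigma rsigma sigmaE] := riesz_measure_exists.
exists sigma => //.
have le_int f : continuous f -> L f <= \int[sigma]_(x in [set: borel K]) f x.
  move=> cf; have [M M0 fM] := continuous_bounded_on_compact cK cf.
  have cM : continuous (cst M : K -> R) by move=> x; exact: cvg_cst.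
  have cfM : continuous (f \+ cst M) by move=> x; apply: cvgD; [exact: cf|exact: cM].
  have fM0 x : 0 <= (f \+ cst M) x.
    by rewrite /= -lerBlDr sub0r; have := fM x; rewrite ler_norml => /andP[].
  have := functional_le_integral sigmaE cfM fM0.
  rewrite LD// (functional_cst LZ L1) RintegralD//; [|exact: continuous_integrable..].
  by rewrite Rintegral_cst// [X in fine X]probability_setT mulr1 lerD2r.
move=> f cf; apply/eqP; rewrite eq_le le_int// andbT.
have cNf : continuous (fun x => -1 * f x).
  by move=> x; apply: cvgM; [exact: cvg_cst|exact: cf].
have := le_int _ cNf; rewrite LZ// RintegralZl//; last exact: continuous_integrable.
by rewrite !mulN1r lerN2.
Qed.

End riesz_markov.

(** * Measures with a density *)

Section density.
Local Open Scope ereal_scope.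
Context d (T : measurableType d) (R : realType).
Variables (mu : {finite_measure set T -> \bar R}) (w : T -> \bar R).
Hypotheses (mw : measurable_fun [set: T] w) (w0 : forall x, 0 <= w x).
Hypothesis iw : mu.-integrable [set: T] w.

Lemma density_measure_fin_num : fin_num_fun (density_measure mu mw w0).
Proof.
move=> A mA; apply: integrable_fin_num => //.
exact: integrableS iw.
Qed.

(** The measure with density [w] is dominated by [mu], and its Radon-Nikodym derivative agrees
    almost everywhere with [w], as both have the same integral over every measurable set. *)
Lemma integral_density (f : T -> \bar R) :
  (density_measure mu mw w0).-integrable [set: T] f ->
  \int[density_measure mu mw w0]_x f x = \int[mu]_x (f x * w x).
Proof.
pose nu : {finite_measure set T -> \bar R} := HB.pack (density_measure mu mw w0)
  (Measure_isFinite.Build _ T R (density_measure mu mw w0) density_measure_fin_num).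
move=> fi; have numu : nu `<< mu.
  apply/null_content_dominatesP => A mA muA0; apply: null_set_integral => //.
  exact: measurable_funTS.
rewrite -[LHS](@Radon_Nikodym_change_of_variables _ _ _ nu mu)//.
have mf := measurable_int _ fi.
apply: ae_eq_integral => //.
- exact: emeasurable_funM.
- exact: emeasurable_funM.
- apply: ae_eqe_mul2l; apply: integral_ae_eq => // [|E _ mE].
    exact: Radon_Nikodym_integrable.
  by rewrite -Radon_Nikodym_integral.
Qed.

End density.

(** * Characters of the Bohr compactification *)

Section complex_topology.
Context {R : realType}.
Local Open Scope complex_scope.

Lemma normc_ge_Re (z : R[i]) : `|complex.Re z| <= ComplexField.Normc.normc z.
Proof.
by case: z => a b /=; rewrite -sqrtr_sqr ler_wsqrtr// lerDl sqr_ge0.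
Qed.

Lemma normc_ge_Im (z : R[i]) : `|complex.Im z| <= ComplexField.Normc.normc z.
Proof.
by case: z => a b /=; rewrite -sqrtr_sqr ler_wsqrtr// lerDr sqr_ge0.
Qed.

Lemma normc_le_ReIm (z : R[i]) :
  ComplexField.Normc.normc z <= `|complex.Re z| + `|complex.Im z|.
Proof.
case: z => a b /=; rewrite -[leRHS]ger0_norm ?addr_ge0// -sqrtr_sqr.
rewrite ler_wsqrtr// sqrrD !real_normK ?num_real// lerD2r lerDl.
by rewrite mulrn_wge0// mulr_ge0.
Qed.

Lemma cvgc_dist {T : Type} {F : set_system T} {FF : Filter F} (u : T -> R[i]^o)
  (l : R[i]^o) : u @ F --> l <->
  (forall e : R, 0 < e -> \forall x \near F, ComplexField.Normc.normc (l - u x) < e).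
Proof.
split => [/cvgrPdist_lt ul e e0|ul].
  have /ul : 0 < e%:C by rewrite ltcR.
  by apply: filterS => x; rewrite -[`|_|]/((ComplexField.Normc.normc (l - u x))%:C) ltcR.
apply/cvgrPdist_lt => e e0.
(* The radius [e] is an element of [R[i]]; positivity in the partial order of [R[i]] forces its
   imaginary part to vanish. *)
have /ltW := e0; rewrite lecE => /andP[/eqP Ie _].
have eE : e = (complex.Re e)%:C by case: (e) Ie => a b /= ->.
have Re0 : 0 < complex.Re e by rewrite -ltcR -eE.
have := ul _ Re0; apply: filterS => x.
by rewrite -ltcR -eE.
Qed.

Lemma cvgc_ReIm {T : Type} {F : set_system T} {FF : Filter F}
  (u : T -> R[i]^o) (l : R[i]^o) : u @ F --> l <->
  (complex.Re (u x) @[x --> F] --> complex.Re l) /\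
  (complex.Im (u x) @[x --> F] --> complex.Im l).
Proof.
split.
  move=> /cvgc_dist ul; split; apply/cvgrPdist_lt => e /ul; apply: filterS => x;
    apply: le_lt_trans.
  - have := normc_ge_Re (l - u x).
    by case: (l) (u x) => a b [a' b'].
  - have := normc_ge_Im (l - u x).
    by case: (l) (u x) => a b [a' b'].
move=> [/cvgrPdist_lt uR /cvgrPdist_lt uI]; apply/cvgc_dist => e e0.
have e20 : 0 < e / 2 by rewrite divr_gt0.
near=> x.
have hR : `|complex.Re l - complex.Re (u x)| < e / 2 by near: x; exact: uR.
have hI : `|complex.Im l - complex.Im (u x)| < e / 2 by near: x; exact: uI.
rewrite (le_lt_trans (normc_le_ReIm _))// [e]splitr.
by move: hR hI; case: (l) (u x) => a b [a' b'] /= hR hI; rewrite ltrD.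
Unshelve. all: by end_near. Qed.

Lemma continuous_ReIm {T : topologicalType} (F : T -> R[i]^o) : continuous F ->
  continuous (fun x => complex.Re (F x)) /\ continuous (fun x => complex.Im (F x)).
Proof.
by move=> cF; split => x; have /cvgc_ReIm[] := cF x.
Qed.

Lemma continuous_real_complex {T : topologicalType} (f : T -> R) : continuous f ->
  continuous (fun x => (f x)%:C : R[i]^o).
Proof. by move=> cf x; apply/cvgc_ReIm; split => /=; [exact: cf|exact: cvg_cst]. Qed.

End complex_topology.

(** * Real trigonometric functions on the Bohr compactification *)

Section bohr_real.
Context {R : realType} (B : bohrCompactification R).
Local Notation emb := (bohr_emb B).

(** The open set [{M < f}], if nonempty, would meet the dense line. Through this, trigonometric
    identities on the line extend to [B]. *)
Lemma bohr_le (f : B -> R) (M : R) : continuous f ->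
  (forall t, f (emb t) <= M) -> forall x, f x <= M.
Proof.
move=> cf fM x; rewrite leNgt; apply/negP => Mx.
have : [set y : B | M < f y] `&` range emb !=set0.
  apply: bohr_emb_dense; first by exists x.
  by apply: (@open_comp _ _ f [set y | M < y]); [move=> y _; exact: cf|exact: open_gt].
by move=> [y [/= Mf [t _ tE]]]; move: Mf; rewrite -tE ltNge fM.
Qed.

Lemma bohr_eq (f g : B -> R) : continuous f -> continuous g ->
  (forall t, f (emb t) = g (emb t)) -> f =1 g.
Proof.
move=> cf cg fg x; apply/eqP; rewrite eq_le -subr_le0 -[in X in _ && X]subr_le0.
have cB (u v : B -> R) : continuous u -> continuous v -> continuous (fun y => u y - v y).
  by move=> cu cv y; apply: cvgB; [exact: cu|exact: cv].
apply/andP; split.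
  by apply: (bohr_le (cB _ _ cf cg)) => t; rewrite fg subrr.
by apply: (bohr_le (cB _ _ cg cf)) => t; rewrite fg subrr.
Qed.

Lemma expi_ap (lam : R) : almost_periodic (fun t => expi (lam * t)).
Proof.
move=> e e0; exists 1%N, (fun=> 1), (fun=> lam) => t.
by rewrite /trig_poly big_ord1 mul1r subrr ComplexField.Normc.normc0.
Qed.

Definition bohr_cos (lam : R) (x : B) : R := complex.Re (bohr_ext B (expi_ap lam) x).
Definition bohr_sin (lam : R) (x : B) : R := complex.Im (bohr_ext B (expi_ap lam) x).

Lemma bohr_cos_continuous lam : continuous (bohr_cos lam).
Proof. exact: (continuous_ReIm (@bohr_ext_continuous _ B _ (expi_ap lam))).1. Qed.

Lemma bohr_sin_continuous lam : continuous (bohr_sin lam).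
Proof. exact: (continuous_ReIm (@bohr_ext_continuous _ B _ (expi_ap lam))).2. Qed.

Lemma bohr_cosE lam t : bohr_cos lam (emb t) = cos (lam * t).
Proof. by rewrite /bohr_cos bohr_extE. Qed.

Lemma bohr_sinE lam t : bohr_sin lam (emb t) = sin (lam * t).
Proof. by rewrite /bohr_sin bohr_extE. Qed.

Lemma bohr_cos0 x : bohr_cos 0 x = 1.
Proof.
apply: (@bohr_eq _ (cst 1)); first exact: bohr_cos_continuous.
  by move=> y; exact: cvg_cst.
by move=> t; rewrite bohr_cosE mul0r cos0.
Qed.

Lemma bohr_sin0 x : bohr_sin 0 x = 0.
Proof.
apply: (@bohr_eq _ (cst 0)); first exact: bohr_sin_continuous.
  by move=> y; exact: cvg_cst.
by move=> t; rewrite bohr_sinE mul0r sin0.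
Qed.

Lemma bohr_cos_le1 lam x : bohr_cos lam x <= 1.
Proof.
apply: bohr_le; first exact: bohr_cos_continuous.
by move=> t; rewrite bohr_cosE cos_le1.
Qed.

Lemma bohr_cosM lam mu x : bohr_cos lam x * bohr_cos mu x =
  (bohr_cos (lam + mu) x + bohr_cos (lam - mu) x) / 2.
Proof.
apply: (@bohr_eq (fun x => bohr_cos lam x * bohr_cos mu x)
   (fun x => (bohr_cos (lam + mu) x + bohr_cos (lam - mu) x) / 2)) => [y|y|t].
- by apply: cvgM; exact: bohr_cos_continuous.
- by apply: cvgM; [apply: cvgD; exact: bohr_cos_continuous|exact: cvg_cst].
- rewrite !bohr_cosE !(mulrDl _ _ t) mulNr !cosD cosN sinN; lra.
Qed.

Lemma bohr_sinM lam mu x : bohr_sin lam x * bohr_cos mu x =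
  (bohr_sin (lam + mu) x + bohr_sin (lam - mu) x) / 2.
Proof.
apply: (@bohr_eq (fun x => bohr_sin lam x * bohr_cos mu x)
   (fun x => (bohr_sin (lam + mu) x + bohr_sin (lam - mu) x) / 2)) => [y|y|t].
- by apply: cvgM; [exact: bohr_sin_continuous|exact: bohr_cos_continuous].
- by apply: cvgM; [apply: cvgD; exact: bohr_sin_continuous|exact: cvg_cst].
- rewrite !bohr_cosE !bohr_sinE !(mulrDl _ _ t) mulNr !sinD cosN sinN; lra.
Qed.

Lemma translation_continuous (a : B) : continuous (fun x : B => a + x).
Proof.
move=> x; apply: (@continuous_comp _ _ _ (fun y : B => (a, y))
  (fun z : B * B => z.1 + z.2)).
  by apply: cvg_pair; [exact: cvg_cst|exact: cvg_id].
exact: add_continuous.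
Qed.

(** The translation is by half a period, which will force the Haar mean to equal its own
    opposite. *)
Lemma bohr_cos_shift lam x : lam != 0 ->
  bohr_cos lam (emb (pi / lam) + x) = - bohr_cos lam x.
Proof.
move=> l0; apply: (@bohr_eq (fun x => bohr_cos lam (emb (pi / lam) + x))
    (fun x => - bohr_cos lam x)) => [y|y|t].
- by apply: continuous_comp; [exact: translation_continuous|exact: bohr_cos_continuous].
- by apply: cvgN; exact: bohr_cos_continuous.
- by rewrite -bohr_embD !bohr_cosE mulrDr mulrCA divff// mulr1 addrC cosDpi.
Qed.

Lemma bohr_sin_shift lam x : lam != 0 ->
  bohr_sin lam (emb (pi / lam) + x) = - bohr_sin lam x.
Proof.
move=> l0; apply: (@bohr_eq (fun x => bohr_sin lam (emb (pi / lam) + x))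
    (fun x => - bohr_sin lam x)) => [y|y|t].
- by apply: continuous_comp; [exact: translation_continuous|exact: bohr_sin_continuous].
- by apply: cvgN; exact: bohr_sin_continuous.
- by rewrite -bohr_embD !bohr_sinE mulrDr mulrCA divff// mulr1 addrC sinDpi.
Qed.

(** The restriction of [f] to the line is almost periodic, and a uniform estimate there extends to
    [B] by density. The final bound is not strict because density preserves only weak
    inequalities. *)
Lemma bohr_approx (f : B -> R) (e : R) : continuous f -> 0 < e ->
  exists n (a b lam : 'I_n -> R), forall x,
    `|f x - \sum_(j < n) (a j * bohr_cos (lam j) x + b j * bohr_sin (lam j) x)| <= e.
Proof.
move=> cf e0.
have /(_ e e0)[n [c [lam H]]] : almost_periodic (fun t => (f (emb t))%:C%C).
  by apply/(bohr_restriction B); exists (fun x => (f x)%:C%C); split => //;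
    exact: continuous_real_complex.
(* As [f] is real, the real part of the approximant is at least as close; the real part of
   [c * expi u] is [Re c * cos u - Im c * sin u]. *)
exists n, (fun j => complex.Re (c j)), (fun j => - complex.Im (c j)), lam => x.
pose g x := \sum_(j < n) (complex.Re (c j) * bohr_cos (lam j) x +
  - complex.Im (c j) * bohr_sin (lam j) x).
rewrite -/(g x).
have cg : continuous g.
  apply: continuous_big => [|j _ y]; first exact: add_continuous.
  apply: cvgD; apply: cvgM; try exact: cvg_cst.
    exact: bohr_cos_continuous.
  exact: bohr_sin_continuous.
apply: (@bohr_le (fun x => `|f x - g x|)) => [y|t].
  by apply: cvg_norm; apply: cvgB; [exact: cf|exact: cg].
apply: (le_trans _ (ltW (H t))); apply: le_trans (normc_ge_Re _).
rewrite [leRHS](_ : _ = `|f (emb t) - g (emb t)|)//; congr (`|_|).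
rewrite raddfB/= /trig_poly raddf_sum/=; congr (_ - _); apply: eq_bigr => j _.
by rewrite bohr_cosE bohr_sinE; case: (c j) => a b /=; rewrite mulNr.
Qed.

End bohr_real.

(** * Fourier coefficients of Riesz products *)

Section fourier.
Context {R : realType} (p : nat -> nat) (s : nat -> nat -> R).
Hypothesis p_gt2 : forall k : nat, (2 < p k)%N.
Hypothesis s0 : forall k : nat, s k 0%N = 0.
Hypothesis s_gt0 : forall k j : nat, (1 <= j <= (p k).-1)%N -> 0 < s k j.

Definition frequency (k j : nat) : R := j%:R * height p s k + sbar s k j.

Let p_gt0 k : (0 < p k)%N.
Proof. exact: leq_trans (p_gt2 k). Qed.

Lemma sbarS k j : sbar s k j.+1 = sbar s k j + s k j.+1.
Proof.
rewrite /sbar big_nat_recr//=; congr (_ + _).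
(* At [j = 0] the convention [sbar s k 0 = 0] agrees with the sum formula because [s k 0 = 0]. *)
by case: j => //; rewrite big_nat1 s0.
Qed.

Lemma height_ge1 k : 1 <= height p s k.
Proof.
elim: k => //= k ih; rewrite -[leLHS]addr0 lerD//.
  rewrite (le_trans ih)// ler_peMl ?(le_trans _ ih)//.
  by rewrite ler1n p_gt0.
(* The upper bound stays fixed during the induction, since spacers are known to be positive only up
   to index [(p k).-1]. *)
have : ((p k).-1 <= (p k).-1)%N by [].
elim: {1 3}(p k).-1 => // j ihj jp; rewrite sbarS addr_ge0 ?ihj ?(ltnW jp)//.
by rewrite ltW// s_gt0.
Qed.

Lemma frequencyS k j :
  frequency k j.+1 = frequency k j + (height p s k + s k j.+1).
Proof. by rewrite /frequency sbarS -natr1; ring. Qed.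

(** Consecutive frequencies differ by the height plus a positive spacer, so one step already gives
    the bound and further steps only increase the difference. *)
Lemma le_frequency_gap k i j : (i < j < p k)%N ->
  height p s k <= frequency k j - frequency k i.
Proof.
move=> /andP[]; elim: j => // j ih; rewrite ltnS leq_eqVlt => + jp.
have sj : 0 <= s k j.+1 by apply/ltW/s_gt0 => /=; rewrite -ltnS prednK ?p_gt0.
move=> /predU1P[ij|ij]; rewrite frequencyS.
  by rewrite ij; lra.
have := ih ij (ltnW jp); have := height_ge1 k; lra.
Qed.

Lemma frequency0 k : frequency k 0 = 0.
Proof. by rewrite /frequency mul0r add0r. Qed.

Lemma frequency_max k : frequency k (p k).-1 = height p s k.+1 - height p s k.
Proof.
have pE : (p k)%:R = (p k).-1%:R + 1 :> R by rewrite natr1 prednK ?p_gt0.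
by rewrite /frequency /= pE; ring.
Qed.

Definition frequency_diff (k i j : nat) : R := frequency k i - frequency k j.

Lemma le_frequency_diff k i j : (i < p k)%N -> (j < p k)%N ->
  `|frequency_diff k i j| <= height p s k.+1 - height p s k.
Proof.
rewrite -frequency_max.
have bnd l : (l < p k)%N -> 0 <= frequency k l <= frequency k (p k).-1.
  have h1 := height_ge1 k; move=> lp; apply/andP; split.
    case: l lp => [|l] lp; first by rewrite frequency0.
    by have := @le_frequency_gap k 0 l.+1 lp; rewrite frequency0; lra.
  have := lp; rewrite -{1}(prednK (p_gt0 k)) ltnS leq_eqVlt => /predU1P[->//|lp1].
  by have := @le_frequency_gap k l (p k).-1; rewrite lp1 ltn_predL p_gt0 => /(_ isT); lra.
move=> /bnd/andP[i1 i2] /bnd/andP[j1 j2].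
by rewrite ler_norml /frequency_diff; apply/andP; split; lra.
Qed.

Lemma ge_frequency_diff k i j : (i < p k)%N -> (j < p k)%N -> i != j ->
  height p s k <= `|frequency_diff k i j|.
Proof.
move=> ip jp; rewrite neq_ltn => /orP[] ij.
  rewrite distrC; apply: le_trans (ler_norm _); apply: le_frequency_gap.
  by rewrite ij.
by apply: le_trans (ler_norm _); apply: le_frequency_gap; rewrite ij.
Qed.

(* [fourier_coef n lam] is the coefficient of frequency [lam] in the product
   of the [|P_k|^2] for [k < n]. *)
Fixpoint fourier_coef (n : nat) (lam : R) : R :=
  if n is k.+1 then
    (p k)%:R^-1 * \sum_(i < p k) \sum_(j < p k)
      (fourier_coef k (lam + frequency_diff k i j) +
       fourier_coef k (lam - frequency_diff k i j)) / 2
  else (lam == 0)%:R.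

Lemma fourier_coef_ge0 n lam : 0 <= fourier_coef n lam.
Proof.
elim: n lam => [|n ih] lam /=; first exact: ler0n.
rewrite mulr_ge0 ?invr_ge0// sumr_ge0// => i _; rewrite sumr_ge0// => j _.
by rewrite divr_ge0// addr_ge0.
Qed.

Lemma average_cst k (x : R) : (p k)%:R^-1 * \sum_(i < p k) x = x.
Proof.
rewrite sumr_const card_ord -[x *+ _]mulr_natl mulKf// pnatr_eq0 -lt0n.
exact: p_gt0.
Qed.

Lemma fourier_coef_nondecreasing lam : nondecreasing_seq (fourier_coef ^~ lam).
Proof.
apply/nondecreasing_seqP => n /=.
rewrite -[leLHS](average_cst n) ler_wpM2l ?invr_ge0//; apply: ler_sum => i _.
(* For each [i] the diagonal term [j = i] returns the old coefficient; averaged over [i], these are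
   the constant term 1 of the new factor. *)
rewrite (bigD1 i)//= /frequency_diff subrr addr0 subr0 mulrDl -splitr lerDl.
by rewrite sumr_ge0// => j _; rewrite divr_ge0// addr_ge0// fourier_coef_ge0.
Qed.

(** Passing from [n] to [n.+1] shifts [lam] by at most the increase of the height, so the bound
    propagates. It starts at [height 0 - 1 = 0], where the only frequency is 0. *)
Lemma fourier_coef_support n lam : height p s n - 1 < `|lam| ->
  fourier_coef n lam = 0.
Proof.
elim: n lam => [|n ih] lam.
  by rewrite /= subrr normr_gt0 => /negbTE ->.
move=> lamn /=; rewrite big1 ?mulr0// => i _; rewrite big1// => j _.
have hd := le_frequency_diff (ltn_ord i) (ltn_ord j).
rewrite !ih ?addr0 ?mul0r//.
  have := lerB_normD lam (- frequency_diff n i j); rewrite normrN.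
  move: lamn hd; lra.
have := lerB_normD lam (frequency_diff n i j).
move: lamn hd; lra.
Qed.

Lemma fourier_coef0 n : fourier_coef n 0 = 1.
Proof.
elim: n => [|n ih] /=; first by rewrite eqxx.
rewrite -[RHS](average_cst n); congr (_ * _); apply: eq_bigr => i _.
rewrite (bigD1 i)//= big1 ?addr0 => [|j ji].
  by rewrite /frequency_diff subrr subr0 add0r ih mulrDl -splitr.
(* An off-diagonal difference has size at least the height, hence falls outside the support of the
   earlier coefficients. *)
have h1 : height p s n - 1 < `|frequency_diff n i j|.
  have := @ge_frequency_diff n i j (ltn_ord i) (ltn_ord j).
  by rewrite eq_sym => /(_ ji); lra.
by rewrite !add0r !fourier_coef_support ?normrN// addr0 mul0r.
Qed.

End fourier.

(** * Haar means of characters and of Riesz products *)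

Section haar_means.
Context {R : realType} (B : bohrCompactification R).
Variable h : probability (borel B) R.
Hypothesis haar : haar_probability h.

Let cB := @bohr_compact R B.

Lemma haar_translation (a : B) (f : B -> R) : continuous f ->
  \int[h]_(x in [set: borel B]) f (a + x) = \int[h]_(x in [set: borel B]) f x.
Proof.
move=> cf; pose phi : borel B -> borel B := fun x => a + (x : B).
have mphi : measurable_fun [set: borel B] phi.
  apply: (@measurability _ _ (borel B) (borel B) setT phi (@open B)) => // _ [U oU <-].
  rewrite setTI; apply: sub_sigma_algebra.
  by apply: (@open_comp _ _ (fun x : B => a + x)) => // x _;
    exact: translation_continuous.
rewrite /Rintegral; congr fine.
have mf := borel_continuous_measurable cf.
transitivity (\int[pushforward h phi]_(x in [set: borel B]) (f x)%:E)%E.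
  rewrite integral_pushforward//=.
  - exact/measurable_EFinP.
  - apply: (continuous_integrable cB h (f := fun x => f (a + x))) => x.
    by apply: continuous_comp; [exact: translation_continuous|exact: cf].
apply: eq_measure_integral => A mA _.
(* Invariance is stated for images: the preimage of [A] under translation by [a] is its image under
   translation by [- a]. *)
rewrite /= /pushforward -[RHS](haar.2 (- a))//; congr (h _).
apply/seteqP; split => x /=.
  by move=> Ax; exists (a + x) => //; rewrite addKr.
by move=> [y Ay <-]; rewrite /phi addNKr.
Qed.

Lemma mean_bohr_cos lam :
  \int[h]_(x in [set: borel B]) bohr_cos lam x = (lam == 0)%:R.
Proof.
have [->|l0] := eqVneq lam 0.
  rewrite (_ : bohr_cos 0 = cst 1); last by apply/funext => x; exact: bohr_cos0.
  by rewrite Rintegral_cst// [X in fine X]probability_setT mulr1.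
rewrite mulr0n; set I := LHS; suff : I = - I by move=> ?; lra.
rewrite {1}/I -(haar_translation (bohr_emb B (pi / lam)))//; last first.
  exact: bohr_cos_continuous.
under eq_Rintegral do rewrite bohr_cos_shift// -mulN1r.
rewrite RintegralZl ?mulN1r//; apply: (continuous_integrable cB).
exact: bohr_cos_continuous.
Qed.

Lemma mean_bohr_sin lam :
  \int[h]_(x in [set: borel B]) bohr_sin lam x = 0.
Proof.
have [->|l0] := eqVneq lam 0.
  rewrite (_ : bohr_sin 0 = cst 0); last by apply/funext => x; exact: bohr_sin0.
  by rewrite Rintegral_cst// mul0r.
set I := LHS; suff : I = - I by move=> ?; lra.
rewrite {1}/I -(haar_translation (bohr_emb B (pi / lam)))//; last first.
  exact: bohr_sin_continuous.
under eq_Rintegral do rewrite bohr_sin_shift// -mulN1r.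
rewrite RintegralZl ?mulN1r//; apply: (continuous_integrable cB).
exact: bohr_sin_continuous.
Qed.

Variables (p : nat -> nat) (s : nat -> nat -> R).
Local Notation d := (frequency_diff p s).

(** On the line, the squares of the cosine sum and of the sine sum expand into products that combine
    pairwise by the formula for the cosine of a difference. *)
Lemma sqr_normc_bohr_poly k (x : B) :
  ComplexField.Normc.normc (bohr_poly p s k x : R[i]) ^+ 2 =
  (p k)%:R^-1 * \sum_(i < p k) \sum_(j < p k) bohr_cos (d k i j) x.
Proof.
pose q x := (p k)%:R^-1 * \sum_(i < p k) \sum_(j < p k) @bohr_cos R B (d k i j) x.
apply: (@bohr_eq _ _
  (fun x => ComplexField.Normc.normc (bohr_poly p s k x : R[i]) ^+ 2) q) => [y|y|t].
- have cN : ComplexField.Normc.normc (bohr_poly p s k z : R[i]) @[z --> y] -->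
      ComplexField.Normc.normc (bohr_poly p s k y : R[i]).
    by apply: continuous_comp; [exact: bohr_ext_continuous|exact: normc_continuous].
  exact: (cvgM cN cN).
- apply: cvgM; first exact: cvg_cst.
  apply: continuous_big => [|i _]; first exact: add_continuous.
  apply: continuous_big => [|j _]; first exact: add_continuous.
  exact: bohr_cos_continuous.
- rewrite /q /bohr_poly bohr_extE /rank_one_poly.
  set c := (Num.sqrt (p k)%:R)^-1.
  have c2 : c ^+ 2 = (p k)%:R^-1 by rewrite exprVn sqr_sqrtr.
  set S := (X in _ * X).
  have ReS : complex.Re S = \sum_(i < p k) cos (t * frequency p s k i).
    by rewrite raddf_sum.
  have ImS : complex.Im S = \sum_(i < p k) sin (t * frequency p s k i).
    by rewrite raddf_sum.
  rewrite -c2; case: S ReS ImS => a b /= -> ->.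
  rewrite sqr_sqrtr ?addr_ge0 ?sqr_ge0// !mul0r subr0 addr0 !exprMn -mulrDr.
  congr (_ * _); rewrite !expr2 !big_distrl/= -big_split/=.
  apply: eq_bigr => i _; rewrite !big_distrr/= -big_split/=.
  apply: eq_bigr => j _; rewrite bohr_cosE /frequency_diff mulrBl cosB.
  by rewrite ![t * _]mulrC.
Qed.

(** The product stops before [n], so the empty product can start the inductions;
    [riesz_product p s n] is the case [n.+1]. *)
Definition partial_riesz (n : nat) (x : B) : R :=
  \prod_(0 <= k < n) ComplexField.Normc.normc (bohr_poly p s k x : R[i]) ^+ 2.

Lemma partial_riesz_continuous n : continuous (partial_riesz n).
Proof.
case: n => [|n]; last exact: riesz_product_continuous.
move=> x; rewrite (_ : partial_riesz 0 = cst 1); first exact: cvg_cst.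
by apply/funext => y; rewrite /partial_riesz big_nil.
Qed.

Lemma partial_riesz_ge0 n x : 0 <= partial_riesz n x.
Proof. by rewrite prodr_ge0// => k _; rewrite sqr_ge0. Qed.

Lemma partial_rieszS n x : partial_riesz n.+1 x =
  (p n)%:R^-1 * \sum_(i < p n) \sum_(j < p n) (partial_riesz n x * bohr_cos (d n i j) x).
Proof.
rewrite /partial_riesz big_nat_recr//= sqr_normc_bohr_poly mulrCA; congr (_ * _).
by rewrite mulr_sumr; apply: eq_bigr => i _; rewrite mulr_sumr.
Qed.

Definition riesz_mean (n : nat) (f : B -> R) : R :=
  \int[h]_(x in [set: borel B]) (f x * partial_riesz n x).

Lemma mulr_partial_riesz_continuous n (f : B -> R) : continuous f ->
  continuous (fun x => f x * partial_riesz n x).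
Proof. by move=> cf x; apply: cvgM; [exact: cf|exact: partial_riesz_continuous]. Qed.

Lemma riesz_meanD n (f g : B -> R) : continuous f -> continuous g ->
  riesz_mean n (f \+ g) = riesz_mean n f + riesz_mean n g.
Proof.
move=> cf cg; rewrite /riesz_mean.
under eq_Rintegral do rewrite /= mulrDl.
by rewrite RintegralD//; apply: (continuous_integrable cB);
  exact: mulr_partial_riesz_continuous.
Qed.

Lemma riesz_meanZ n (a : R) (f : B -> R) : continuous f ->
  riesz_mean n (fun x => a * f x) = a * riesz_mean n f.
Proof.
move=> cf; rewrite /riesz_mean.
under eq_Rintegral do rewrite -mulrA.
by rewrite RintegralZl//; apply: (continuous_integrable cB);
  exact: mulr_partial_riesz_continuous.
Qed.

Lemma riesz_mean_ge0 n (f : B -> R) : (forall x, 0 <= f x) -> 0 <= riesz_mean n f.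
Proof.
by move=> f0; apply: Rintegral_ge0 => x _; rewrite mulr_ge0// partial_riesz_ge0.
Qed.

Lemma riesz_mean_sum n m (F : 'I_m -> B -> R) : (forall i, continuous (F i)) ->
  riesz_mean n (fun x => \sum_(i < m) F i x) = \sum_(i < m) riesz_mean n (F i).
Proof.
elim: m F => [|m ih] F cF.
  rewrite big_ord0 /riesz_mean; under eq_Rintegral do rewrite big_ord0 mul0r.
  by rewrite Rintegral_cst// mul0r.
rewrite big_ord_recr/= -ih// -riesz_meanD//; last first.
  by apply: continuous_big => [|i _]; [exact: add_continuous|exact: cF].
by apply: eq_Rintegral => x _; rewrite big_ord_recr.
Qed.

(** The family [v] stands for cosines or sines: both obey the same product-to-sum rule against a
    cosine, so expanding the last factor gives one recursion for both. *)
Lemma riesz_meanS n (v : R -> B -> R) lam :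
  (forall mu, continuous (v mu)) ->
  (forall mu x, v lam x * bohr_cos mu x = (v (lam + mu) x + v (lam - mu) x) / 2) ->
  riesz_mean n.+1 (v lam) = (p n)%:R^-1 * \sum_(i < p n) \sum_(j < p n)
      (riesz_mean n (v (lam + d n i j)) + riesz_mean n (v (lam - d n i j))) / 2.
Proof.
move=> cv vM.
pose w i j (x : B) := 2^-1 * (v (lam + d n i j) \+ v (lam - d n i j)) x.
have cvD mu nu : continuous (v mu \+ v nu).
  by move=> x; apply: cvgD; exact: cv.
have cw i j : continuous (w i j).
  by move=> x; apply: cvgM; [exact: cvg_cst|exact: cvD].
have cws i : continuous (fun x => \sum_(j < p n) w i j x).
  by apply: continuous_big => [|j _]; [exact: add_continuous|exact: cw].
transitivity (riesz_mean n (fun x =>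
    (p n)%:R^-1 * \sum_(i < p n) \sum_(j < p n) w i j x)).
  apply: eq_Rintegral => x _; rewrite partial_rieszS mulrCA -mulrA; congr (_ * _).
  rewrite mulr_sumr mulr_suml; apply: eq_bigr => i _.
  rewrite mulr_sumr mulr_suml; apply: eq_bigr => j _.
  by rewrite mulrCA mulrC vM /w [2^-1 * _]mulrC.
rewrite riesz_meanZ; last first.
  by apply: continuous_big => [|i _]; [exact: add_continuous|exact: cws].
rewrite riesz_mean_sum//; congr (_ * _); apply: eq_bigr => i _.
rewrite riesz_mean_sum//; apply: eq_bigr => j _.
by rewrite riesz_meanZ// riesz_meanD// mulrC.
Qed.

Lemma riesz_mean_cos n lam : riesz_mean n (bohr_cos lam) = fourier_coef p s n lam.
Proof.
elim: n lam => [|n ih] lam.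
  rewrite /riesz_mean; under eq_Rintegral do rewrite /partial_riesz big_nil mulr1.
  exact: mean_bohr_cos.
rewrite riesz_meanS/=; last 2 first.
  exact: bohr_cos_continuous.
  by move=> mu x; exact: bohr_cosM.
congr (_ * _); apply: eq_bigr => i _; apply: eq_bigr => j _.
by rewrite !ih.
Qed.

Lemma riesz_mean_sin n lam : riesz_mean n (bohr_sin lam) = 0.
Proof.
elim: n lam => [|n ih] lam.
  rewrite /riesz_mean; under eq_Rintegral do rewrite /partial_riesz big_nil mulr1.
  exact: mean_bohr_sin.
rewrite riesz_meanS/=; last 2 first.
  exact: bohr_sin_continuous.
  by move=> mu x; exact: bohr_sinM.
rewrite big1 ?mulr0// => i _; rewrite big1// => j _.
by rewrite !ih addr0 mul0r.
Qed.

End haar_means.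

(** * Weak-star convergence *)

Section riesz_limit.
Context {R : realType} (B : bohrCompactification R).
Variable h : probability (borel B) R.
Hypothesis haar : haar_probability h.
Variables (p : nat -> nat) (s : nat -> nat -> R).
Hypothesis p_gt2 : forall k : nat, (2 < p k)%N.
Hypothesis s0 : forall k : nat, s k 0%N = 0.
Hypothesis s_gt0 : forall k j : nat, (1 <= j <= (p k).-1)%N -> 0 < s k j.

Local Notation I := (riesz_mean h p s).

Let ID n := @riesz_meanD R B h p s n.
Let IZ n := @riesz_meanZ R B h p s n.
Let I_ge0 n (f : B -> R) (_ : continuous f) := @riesz_mean_ge0 R B h p s n f.

Let I1 n : I n (cst 1) = 1.
Proof.
rewrite (_ : cst 1 = bohr_cos 0); last by apply/funext => x; rewrite bohr_cos0.
by rewrite riesz_mean_cos// fourier_coef0.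
Qed.

(** Positivity and total mass 1 give a contraction whose constant does not depend on [n]. *)
Lemma riesz_mean_dist n (f g : B -> R) e : continuous f -> continuous g ->
  (forall x, `|f x - g x| <= e) -> `|I n f - I n g| <= e.
Proof.
move=> cf cg fg; rewrite -(functionalB (ID n) (IZ n))// ler_norml.
have cfg : continuous (fun x => f x - g x).
  by move=> x; apply: cvgB; [exact: cf|exact: cg].
rewrite -[- e](functional_cst (IZ n) (I1 n)).
rewrite -[X in _ && (_ <= X)](functional_cst (IZ n) (I1 n)).
apply/andP; split; apply: (le_functional (ID n) (IZ n) (I_ge0 n)) => // x;
  by [exact: cvg_cst|have := fg x; rewrite ler_norml => /andP[]].
Qed.

Lemma cvg_riesz_mean_cos lam : cvgn (fun n => I n (bohr_cos lam)).
Proof.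
apply: nondecreasing_is_cvgn.
  move=> m n mn; rewrite !riesz_mean_cos//.
  exact: (fourier_coef_nondecreasing s p_gt2).
exists 1 => _ [n _ <-]; rewrite -(I1 n).
apply: (le_functional (ID n) (IZ n) (I_ge0 n)); first exact: bohr_cos_continuous.
  by move=> x; exact: cvg_cst.
exact: bohr_cos_le1.
Qed.

Lemma cvg_riesz_mean (f : B -> R) : continuous f -> cvgn (I ^~ f).
Proof.
(* It suffices to find, for each [e], a point eventually within [e] of the sequence: the limit of
   the means of a trigonometric polynomial uniformly [e / 2]-close to [f]. *)
move=> cf; apply: cauchy_cvg; apply: cauchy_exP => e e0.
have e20 : 0 < e / 2 by rewrite divr_gt0.
have [m [a [b [lam fg]]]] := bohr_approx cf e20.
pose u j := (fun x => a j * bohr_cos (lam j) x) \+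
  (fun x => b j * bohr_sin (lam j) x) : B -> R.
pose g (x : B) := \sum_(j < m) u j x.
have cc j : continuous (fun x : B => a j * bohr_cos (lam j) x).
  by move=> x; apply: cvgM; [exact: cvg_cst|exact: bohr_cos_continuous].
have cs j : continuous (fun x : B => b j * bohr_sin (lam j) x).
  by move=> x; apply: cvgM; [exact: cvg_cst|exact: bohr_sin_continuous].
have cu j : continuous (u j) by move=> x; apply: cvgD; [exact: cc|exact: cs].
have cg : continuous g.
  by apply: continuous_big => [|j _]; [exact: add_continuous|exact: cu].
have Ig n : I n g = \sum_(j < m) a j * I n (bohr_cos (lam j)).
  rewrite riesz_mean_sum//; apply: eq_bigr => j _.
  rewrite ID// !IZ ?riesz_mean_sin ?mulr0 ?addr0//.
    exact: bohr_sin_continuous.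
  exact: bohr_cos_continuous.
have : cvgn (I ^~ g).
  under eq_fun do rewrite Ig.
  apply/cvg_ex; exists (\sum_(j < m) a j * limn (fun n => I n (bohr_cos (lam j)))).
  apply: cvg_big => [|j _]; first exact: add_continuous.
  by apply: cvgM; [exact: cvg_cst|exact: cvg_riesz_mean_cos].
move=> /cvg_ex[l /cvgrPdist_lt/(_ _ e20) lg]; exists l.
apply: filterS lg => n /= lg; rewrite /ball/= [e]splitr.
rewrite -(subrKA (I n g)) (le_lt_trans (ler_normD _ _))// ltr_leD//.
by rewrite distrC; apply: riesz_mean_dist.
Qed.

Lemma Rintegral_riesz_measure n (f : B -> R) : continuous f ->
  \int[riesz_measure p s h n]_(x in [set: borel B]) f x = I n.+1 f.
Proof.
move=> cf; have cB := @bohr_compact R B.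
have iw : h.-integrable [set: borel B] (EFin \o (riesz_product p s n : borel B -> R)).
  by apply: continuous_integrable => //; exact: riesz_product_continuous.
pose w := density_measure h (@measurable_riesz_product R p s B n)
  (@riesz_product_ge0 R p s B n).
pose nu : {finite_measure set (borel B) -> \bar R} := HB.pack w
  (Measure_isFinite.Build _ (borel B) R w (density_measure_fin_num _ _ iw)).
rewrite /Rintegral /riesz_measure integral_density//.
exact: (continuous_integrable cB nu cf).
Qed.

Lemma weak_star_cvg_riesz_measure : exists sigma : probability (borel B) R,
  regular sigma /\ weak_star_cvg (riesz_measure p s h) sigma.
Proof.
pose L (f : B -> R) := limn (I ^~ f).
have LD (f g : B -> R) : continuous f -> continuous g -> L (f \+ g) = L f + L g.
  move=> cf cg; rewrite /L; under eq_fun do rewrite ID//.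
  by rewrite limD//; exact: cvg_riesz_mean.
have LZ (a : R) (f : B -> R) : continuous f -> L (fun x => a * f x) = a * L f.
  move=> cf; rewrite /L; under eq_fun do rewrite IZ//.
  apply: cvg_lim => //; apply: cvgM; first exact: cvg_cst.
  exact: cvg_riesz_mean.
have L_ge0 (f : B -> R) : continuous f -> (forall x, 0 <= f x) -> 0 <= L f.
  move=> cf f0; apply: limr_ge; first exact: cvg_riesz_mean.
  by apply: nearW => n; exact: riesz_mean_ge0.
have L1 : L (cst 1) = 1.
  by rewrite /L; under eq_fun do rewrite I1; exact: lim_cst.
have [sigma rsigma sigmaL] :=
  riesz_markov (@bohr_hausdorff R B) (@bohr_compact R B) LD LZ L_ge0 L1.
exists sigma; split => // F cF.
have cvgI (f : B -> R) : continuous f ->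
    \int[riesz_measure p s h n]_(x in [set: borel B]) f x @[n --> \oo] -->
    \int[sigma]_(x in [set: borel B]) f x.
  move=> cf; under eq_fun do rewrite Rintegral_riesz_measure//.
  (* The measures correspond to the means of index [n.+1]; dropping the first term leaves the limit
     unchanged. *)
  rewrite sigmaL//; have : I ^~ f @ \oo --> L f by exact: cvg_riesz_mean.
  by rewrite -cvg_shiftS.
have [cR cI] := continuous_ReIm cF.
by apply/cvgc_ReIm; split; exact: cvgI.
Qed.

End riesz_limit.

Theorem theorem3p1 (R : realType) (B : bohrCompactification R)
    (h : probability (borel B) R) (p : nat -> nat) (s : nat -> nat -> R) :
  haar_probability h ->
  (forall k : nat, (2 < p k)%N) ->
  (forall k : nat, s k 0%N = 0) ->
  (forall k j : nat, (1 <= j <= (p k).-1)%N -> 0 < s k j) ->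
  exists sigma : probability (borel B) R,
    regular sigma /\ weak_star_cvg (riesz_measure p s h) sigma.
Proof. by move=> haar p_gt2 s0 s_gt0; exact: weak_star_cvg_riesz_measure. Qed.
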